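(* Let $n\ge1$ be an integer, and let a society consist of $n$ egoists, the utility increments in a random proposal being independent random variables with the symmetrized Pareto distribution with parameters $\mu\in\mathbb{R}$, $\sigma>0$ and $k>2$. Let $\rho=\frac{\mu}{\sigma}$, $C=\sqrt{\frac{(k-1)(k-2)}{2}}=\frac{a}{\sigma}$, and $\hat\rho=|\rho/C|=|\mu/a|$. Then $$\alpha_0=\frac12\left(1+\mathrm{sign}(\rho)\,\frac{1-(k-2)\hat\rho-(1+\hat\rho)^{-k+1}}{1+k\hat\rho}\right)$$ is an optimal majority/acceptance threshold, i.e. $\mathrm{E}(\eta_i(\alpha_0))\ge \mathrm{E}(\eta_i(\alpha))$ for every $\alpha\in[-\frac1n,1]$ and every $i\in\{1,\dots,n\}$.
   Context: Symmetrized Pareto distribution: for $k>2$, $a>0$ and $\mu\in\mathbb{R}$ it is the distribution with density $$f(x)=\frac{k}{2a}\left(\frac{|x-\mu|}{a}+1\right)^{-(k+1)},\quad x\in\mathbb{R}.$$ Here $\mu$ is the mode, median and mean, and $\sigma$ denotes the standard deviation; $a=\sigma\sqrt{\frac{(k-1)(k-2)}{2}}$, so the distribution is parametrized by $\mu,\sigma,k$. $\mathrm{sign}(\rho)$ is $1,0,-1$ for $\rho>0$, $\rho=0$, $\rho<0$ respectively. Setting (ViSE model, society of $n$ egoists): a random proposal is a vector $\boldsymbol\zeta=(\zeta_1,\ldots,\zeta_n)$ of independent identically distributed real random variables; $\zeta_i$ is the proposed utility increment of agent $i$. Each agent votes for the proposal if and only if his/her own proposed increment is positive. For a relative voting threshold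 $\alpha\in[-\frac1n,1]$, the proposal is accepted if and only if $\#\{k:\zeta_k>0,\ k=1,\ldots,n\}>\alpha n$. The actual utility increments are $\eta_i(\alpha)=\zeta_i\, I(\boldsymbol\zeta,\alpha n)$, where $I(\boldsymbol\zeta,\alpha n)=1$ if $\#\{k:\zeta_k>0\}>\alpha n$ and $I(\boldsymbol\zeta,\alpha n)=0$ otherwise. A threshold in $[-\frac1n,1]$ is called optimal if it provides the highest possible expected utility increment $\mathrm{E}(\eta_i(\alpha))$ of an agent (this expectation does not depend on $i$); optimal thresholds are not unique. *)

(* Defs.v *)
From HB Require Import structures.
From mathcomp Require Import all_boot all_order all_algebra.
From mathcomp Require Import all_classical all_reals all_analysis.

Set Implicit Arguments.
Unset Strict Implicit.
Unset Printing Implicit Defensive.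

Import Order.TTheory GRing.Theory Num.Theory.
Import numFieldNormedType.Exports.

Local Open Scope classical_set_scope.
Local Open Scope ring_scope.

Section SymmetrizedPareto.
Context {R : realType}.

Definition spareto_pdf (mu a k x : R) : R :=
  k / (2 * a) * (`|x - mu| / a + 1) `^ (- (k + 1)).

(* The ratio a / sigma: the distribution with scale a and shape k > 2 has
   variance 2 a^2 / ((k - 1) (k - 2)). *)
Definition spareto_ratio (k : R) : R := Num.sqrt ((k - 1) * (k - 2) / 2).

(* The distribution is parametrized by its standard deviation sigma. *)
Definition spareto_prob (mu sigma k : R) (A : set R) : \bar R :=
  (\int[lebesgue_measure]_(x in A)
     (spareto_pdf mu (sigma * spareto_ratio k) k x)%:E)%E.

End SymmetrizedPareto.

Section Independence.
Context {R : realType} {d : measure_display} {T : measurableType d}.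

Definition mutually_independent (P : probability T R) (I : finType)
    (X : I -> {RV P >-> R}) : Prop :=
  forall (J : {set I}) (B : I -> set R), (forall i, measurable (B i)) ->
  P (\bigcap_(i in [set` J]) X i @^-1` B i) =
  (\prod_(i in J) P (X i @^-1` B i))%E.

End Independence.

Section ViSE.
Context {R : realType} {d : measure_display} {T : measurableType d}.
Variables (P : probability T R) (n : nat) (zeta : 'I_n -> {RV P >-> R}).

Definition votes_for (w : T) : nat := #|[set j : 'I_n | 0 < zeta j w]%SET|.

Definition accepted (alpha : R) (w : T) : bool :=
  alpha * n%:R < (votes_for w)%:R.

Definition actual_increment (alpha : R) (i : 'I_n) (w : T) : R :=
  zeta i w * (accepted alpha w)%:R.

Definition optimal_threshold (alpha : R) : Prop :=
  alpha \in `[- n%:R^-1, 1] /\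
  forall beta : R, beta \in `[- n%:R^-1, 1] -> forall i : 'I_n,
    ('E_P[actual_increment beta i] <= 'E_P[actual_increment alpha i])%E.

End ViSE.

(* Main.v *)
Require Import Defs.
From mathcomp Require Import all_boot all_order all_algebra.
From mathcomp Require Import perm ring lra.
From mathcomp Require Import all_classical all_reals all_analysis.
From mathcomp Require Import measurable_realfun.

Set Implicit Arguments.
Unset Strict Implicit.
Unset Printing Implicit Defensive.

Import Order.TTheory GRing.Theory Num.Theory.
Import numFieldNormedType.Exports.

Local Open Scope classical_set_scope.
Local Open Scope ring_scope.

(** Condition on the set [S] of agents whose proposed increment is positive.
    With [p] the probability of a positive increment and [U], [V] the means of
    its positive and negative parts, independence gives each pattern [S] the
    weight [p ^ |S| * (1 - p) ^ (n - |S|)], and given [S] an agent expects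
    [U / p] inside [S] and [- V / (1 - p)] outside.  The expected actual
    increment at threshold [alpha] is the sum of these contributions over the
    patterns with [|S| > alpha n] ([expectation_actual_increment]).  It is the
    same for all agents, so it may be averaged over them; the contribution of
    [S] to the average then has the sign of
      [|S| * (U / p) - (n - |S|) * (V / (1 - p))],
    an increasing affine function of [|S|] whose zero is at [|S| = alpha0 * n]
    with [alpha0 = V p / (U (1 - p) + V p)].  The threshold [alpha0] thus
    accepts exactly the patterns with a positive contribution, and no other
    threshold can do better ([optimal_threshold_of_means]).

    It remains to find [p], [U] and [V] for the symmetrized Pareto law.
    Integrating the density gives the upper tail [1/2 (1 + t/a) ^ (- k)] at
    distance [t >= 0] from [mu]; integrating this tail gives the mean excess
    over any level [c >= mu] ([expectation_spareto_excess]).  The negation of a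
    variable has the law with centre [- mu], so the lower tail follows by
    symmetry.  Equal excesses on both sides of [mu] show that the mean is [mu],
    whence [U - V = mu]: of the two parts only the one beyond [0], seen from
    [mu], has to be integrated ([spareto_nonpos_parts]).  Substitution in
    [alpha0] is then field arithmetic ([spareto_threshold]); the case [mu > 0]
    is the mirror image of [mu <= 0]. *)

(** * Integrability from the positive and negative parts *)

Section PosNegParts.
Context {R : realType} {d : measure_display} {T : measurableType d}.
Variable P : probability T R.

Lemma ge0_Lfun1 (Z : {RV P >-> R}) (r : R) : (forall w, 0 <= Z w) ->
  ('E_P[Z] = r%:E)%E -> (Z : T -> R) \in Lfun P 1.
Proof.
move=> Z0 EZ; apply/Lfun1_integrable/integrableP; split.
  exact/measurable_EFinP.
rewrite (eq_integral (EFin \o Z)) => [|w _].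
  by move: EZ; rewrite unlock => ->; rewrite ltry.
by rewrite /= ger0_norm.
Qed.

Lemma expectation_funrposneg (X : {RV P >-> R}) (U V : R) :
  ('E_P[(X^\+)%R] = U%:E)%E -> ('E_P[(X^\-)%R] = V%:E)%E ->
  (X : T -> R) \in Lfun P 1 /\ ('E_P[X] = (U - V)%:E)%E.
Proof.
move=> EU EV.
have Lp : (X^\+ : T -> R)%R \in Lfun P 1.
  by apply: (ge0_Lfun1 _ EU) => w; exact: funrpos_ge0.
have Ln : (X^\- : T -> R)%R \in Lfun P 1.
  by apply: (ge0_Lfun1 _ EV) => w; exact: funrneg_ge0.
split; first by rewrite -(funrposBneg X) rpredB.
by rewrite -[in LHS](funrposBneg X) expectationB// EU EV EFinB.
Qed.

End PosNegParts.

(** * Tail integrals of a power of an affine function *)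

Section PowerTail.
Context {R : realType}.
Implicit Types a m p s x : R.

Lemma is_derive_powR_affine a m p x : 0 < (x - m) / a + 1 ->
  is_derive x 1 (fun y : R => ((y - m) / a + 1) `^ p)
    (p * ((x - m) / a + 1) `^ (p - 1) / a).
Proof.
move=> h.
have h1 : is_derive x 1 (fun y : R => (y - m) / a + 1) a^-1.
  apply: is_derive_eq.
  by rewrite addr0 subr0 /GRing.scale/= mulr0 add0r mulr1.
exact: (@is_derive1_comp R (fun y : R => y `^ p) (fun y : R => (y - m) / a + 1)
  x _ _ (is_derive1_powR p h) h1).
Qed.

Lemma continuous_powR_affine a m p x : 0 < (x - m) / a + 1 ->
  {for x, continuous (fun y : R => ((y - m) / a + 1) `^ p)}.
Proof.
move=> /is_derive_powR_affine h.
apply/differentiable_continuous/derivable1_diffP.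
by case: (h p).
Qed.

Lemma measurable_powR_affine a m p (D : set R) :
  measurable_fun D (fun y : R => ((y - m) / a + 1) `^ p).
Proof.
apply: (@measurableT_comp _ _ _ _ _ _ (fun y : R => y `^ _)) => //.
apply: measurable_funD => //; apply: measurable_funM => //.
exact: measurable_funB.
Qed.

Lemma cvg_powR_affine a m p : 0 < a -> 0 < p ->
  ((x - m) / a + 1) `^ (- p) @[x --> +oo] --> 0.
Proof.
move=> a0 p0.
have ly : ln x @[x --> +oo] --> (+oo : set_system R).
  apply/cvgryPge => A; near=> x.
  have Ax : expR A <= x by near: x; apply: nbhs_pinfty_ge; rewrite num_real.
  by rewrite -(expRK A) ler_ln ?posrE ?(lt_le_trans _ Ax) ?expR_gt0.
have aff : (x - m) / a + 1 @[x --> +oo] --> (+oo : set_system R).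
  apply: (@cvg_comp _ _ _ (fun x => (x - m) / a) (fun y => y + 1) _ +oo).
    apply: gt0_cvgMly; rewrite ?invr_gt0//; exact: cvg_addrr.
  exact: cvg_addrr.
have pexp : y `^ (- p) @[y --> +oo] --> 0.
  apply: (@cvg_trans _ ((expR (- (p * ln y))) @[y --> +oo])).
    apply: near_eq_cvg; near=> y.
    by rewrite /powR gt_eqF ?mulNr//; near: y;
      by apply: nbhs_pinfty_gt; rewrite num_real.
  apply: (@cvg_comp _ _ _ (fun y => p * ln y) (fun z => expR (- z)) _ +oo).
    exact: gt0_cvgMry.
  exact: cvgr_expR.
exact: (cvg_comp _ _ aff pexp).
Unshelve. all: by end_near. Qed.

(** Fundamental theorem of calculus on a half-line: the primitive is a multiple
    of the power [1 - p] and vanishes at infinity because [1 < p]. *)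
Lemma integral_powR_affine a m p s : 0 < a -> 1 < p -> 0 < (s - m) / a + 1 ->
  (\int[lebesgue_measure]_(x in `[s, +oo[) (((x - m) / a + 1) `^ (- p))%:E =
   (a / (p - 1) * ((s - m) / a + 1) `^ (1 - p))%:E)%E.
Proof.
move=> a0 p1 s0.
have pos x : s <= x -> 0 < (x - m) / a + 1.
  move=> sx; apply: (lt_le_trans s0).
  by rewrite lerD2r ler_pM2r ?invr_gt0// lerD2r.
pose F (x : R) := - (a / (p - 1)) * ((x - m) / a + 1) `^ (1 - p).
have pB0 : p - 1 != 0 by rewrite subr_eq0 gt_eqF.
have dF x : s <= x -> is_derive x 1 F (((x - m) / a + 1) `^ (- p)).
  move=> /pos /is_derive_powR_affine h.
  have := h (1 - p) => {}h.
  apply: is_derive_eq.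
  rewrite /GRing.scale/= addrAC subrr add0r.
  by field; rewrite pB0 gt_eqF.
have cF x : s <= x -> {for x, continuous F}.
  move=> /dF h.
  by apply/differentiable_continuous/derivable1_diffP; case: h.
have -> : a / (p - 1) * ((s - m) / a + 1) `^ (1 - p) = 0 - F s.
  by rewrite /F sub0r mulNr opprK.
rewrite EFinB; apply: ge0_continuous_FTC2y.
- by move=> x _; exact: powR_ge0.
- apply/continuous_within_itvcyP; split.
    move=> x; rewrite in_itv/= andbT => sx.
    by apply/continuous_powR_affine/pos/ltW.
  by apply/cvg_at_right_filter/continuous_powR_affine.
- rewrite -[X in _ --> X](mulr0 (- (a / (p - 1)))); apply: cvgMr.
  rewrite -opprB; apply: cvg_powR_affine => //.
  by rewrite subr_gt0.
- by move=> x /ltW /dF[].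
- by apply/cvg_at_right_filter/cF.
- move=> x; rewrite in_itv/= andbT => /ltW /dF h.
  by rewrite derive1E; apply: derive_val.
Qed.

End PowerTail.


(** * The symmetrized Pareto law *)

Section SymmetrizedParetoLaw.
Context {R : realType}.
Implicit Types a k mu x c : R.

Lemma ge0_integral_opp (f : R -> \bar R) (A : set R) :
  measurable A -> measurable_fun [set: R] f -> (forall x, (0 <= f x)%E) ->
  (\int[lebesgue_measure]_(x in A) f x =
   \int[lebesgue_measure]_(x in -%R @^-1` A) f (- x)%R)%E.
Proof.
move=> mA mf f0.
transitivity (\int[pushforward lebesgue_measure
    (-%R : R -> measurableTypeR R)]_(x in A) f x)%E.
  by apply: eq_measure_integral => B mB _; exact/esym/lebesgue_measureN.
rewrite ge0_integral_pushforward//; exact: measurable_funTS.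
Qed.

Lemma spareto_pdf_ge0 mu a k x : 0 < a -> 0 < k -> 0 <= spareto_pdf mu a k x.
Proof.
by move=> a0 k0; rewrite mulr_ge0 ?powR_ge0// divr_ge0 ?mulr_ge0 ?ltW.
Qed.

Lemma spareto_pdfN mu a k x :
  spareto_pdf mu a k (- x) = spareto_pdf (- mu) a k x.
Proof. by rewrite /spareto_pdf opprK -normrN opprD !opprK. Qed.

Lemma measurable_spareto_pdf mu a k :
  measurable_fun [set: R] (spareto_pdf mu a k).
Proof.
apply: measurable_funM => //.
apply: (@measurableT_comp _ _ _ _ _ _ (fun y : R => y `^ _)) => //.
apply: measurable_funD => //; apply: measurable_funM => //.
apply: measurableT_comp => //; exact: measurable_funB.
Qed.

Lemma spareto_upper_tail mu a k c : 0 < a -> 0 < k -> mu <= c ->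
  (\int[lebesgue_measure]_(x in `[c, +oo[) (spareto_pdf mu a k x)%:E =
   (2^-1 * ((c - mu) / a + 1) `^ (- k))%:E)%E.
Proof.
move=> a0 k0 muc.
have c0 : 0 < (c - mu) / a + 1.
  by rewrite ltr_wpDl// divr_ge0 ?subr_ge0// ltW.
transitivity (\int[lebesgue_measure]_(x in `[c, +oo[)
    ((k / (2 * a))%:E * (((x - mu) / a + 1) `^ (- (k + 1)))%:E))%E.
  apply: eq_integral => x; rewrite inE/= in_itv/= andbT => cx.
  by rewrite -EFinM /spareto_pdf ger0_norm// subr_ge0 (le_trans muc).
rewrite ge0_integralZl_EFin//=; last 3 first.
- by move=> x _; rewrite lee_fin powR_ge0.
- by apply/measurable_EFinP; exact: measurable_powR_affine.
- by rewrite divr_ge0 ?mulr_ge0 ?ltW.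
rewrite integral_powR_affine// ?ltrDr// -EFinM; congr EFin.
have -> : 1 - (k + 1) = - k by ring.
by rewrite addrK; field; rewrite !gt_eqF.
Qed.

End SymmetrizedParetoLaw.

Section SymmetrizedParetoVariable.
Context {R : realType} {d : measure_display} {T : measurableType d}.
Variables (P : probability T R).

(** [a] is the scale parameter, so that [spareto_prob] is the case
    [a = sigma * spareto_ratio k]. *)
Definition spareto_law (X : {RV P >-> R}) (mu a k : R) : Prop :=
  forall A : set R, measurable A -> distribution P X A =
    (\int[lebesgue_measure]_(x in A) (spareto_pdf mu a k x)%:E)%E.

Variables (mu a k : R) (a_gt0 : 0 < a) (k_gt1 : 1 < k).

Let k_gt0 : 0 < k. Proof. exact: lt_trans k_gt1. Qed.

(** The density is symmetric about [mu] and Lebesgue measure is invariant under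
    negation; this reduces every lower-tail computation to an upper-tail one. *)
Lemma spareto_lawN (X : {RV P >-> R}) :
  spareto_law X mu a k -> spareto_law (- X : {mfun T >-> R}) (- mu) a k.
Proof.
move=> lawX A mA.
have mNA : measurable (-%R @^-1` A : set R).
  by rewrite -[X in measurable X]setTI; exact: oppr_measurable.
have -> : distribution P (- X : {mfun T >-> R}) A =
    distribution P X (-%R @^-1` A) by [].
rewrite (lawX _ mNA) ge0_integral_opp//.
- congr (integral _ _ _).
    by apply/seteqP; split => x /=; rewrite opprK.
  by apply/funext => x; rewrite spareto_pdfN.
- by apply/measurable_EFinP; exact: measurable_spareto_pdf.
- by move=> x; rewrite lee_fin spareto_pdf_ge0.
Qed.

Lemma ccdf_spareto (X : {RV P >-> R}) c : spareto_law X mu a k -> mu <= c ->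
  ccdf X c = (2^-1 * ((c - mu) / a + 1) `^ (- k))%:E.
Proof.
move=> lawX muc; rewrite /ccdf lawX// integral_itv_obnd_cbnd.
  exact: spareto_upper_tail.
apply: measurable_funTS; apply/measurable_EFinP.
exact: measurable_spareto_pdf.
Qed.

(** The expectation of a nonnegative variable is the integral of its upper
    tail, and the tail of [(X - c)^+] at [r >= 0] is that of [X] at [r + c],
    again a power of an affine function. *)
Lemma expectation_spareto_excess (X : {RV P >-> R}) c :
  spareto_law X mu a k -> mu <= c ->
  ('E_P[((X \- cst c)^\+)%R] =
   (a / (2 * (k - 1)) * ((c - mu) / a + 1) `^ (1 - k))%:E)%E.
Proof.
move=> lawX muc.
rewrite ge0_expectation_ccdf; last by move=> w; exact: funrpos_ge0.
transitivity (\int[lebesgue_measure]_(r in `[0%R, +oo[)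
    ((2^-1)%:E * (((r - (mu - c)) / a + 1) `^ (- k))%:E))%E.
  apply: eq_integral => r; rewrite inE/= in_itv/= andbT => r0.
  have -> : ccdf (P := P) (X \- cst c)^\+ r = ccdf X (r + c).
    congr (P _); apply/seteqP; split => w /=; rewrite !in_itv/= !andbT;
      by rewrite /funrpos lt_max/= ltrBrDr [r < 0]ltNge r0 orbF.
  rewrite ccdf_spareto//; last by rewrite (le_trans muc)// lerDr.
  by rewrite -EFinM; congr (_ * (_ / _ + _) `^ _)%:E; ring.
rewrite ge0_integralZl_EFin//=; last 2 first.
- by move=> x _; rewrite lee_fin powR_ge0.
- by apply/measurable_EFinP; exact: measurable_powR_affine.
rewrite integral_powR_affine//; last first.
  by rewrite sub0r opprB ltr_wpDl// divr_ge0 ?subr_ge0// ltW.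
rewrite -EFinM sub0r opprB; congr EFin.
by field; rewrite subr_eq0 gt_eqF.
Qed.

End SymmetrizedParetoVariable.

Section SymmetrizedParetoMoments.
Context {R : realType} {d : measure_display} {T : measurableType d}.
Variables (P : probability T R) (mu a k : R) (a_gt0 : 0 < a) (k_gt1 : 1 < k).

(** By symmetry the mean excesses of [X] above and below [mu] coincide; being
    finite, they cancel in the expectation of [X - mu]. *)
Lemma expectation_spareto (X : {RV P >-> R}) : spareto_law X mu a k ->
  (X : T -> R) \in Lfun P 1 /\ ('E_P[X] = mu%:E)%E.
Proof.
move=> lawX.
have Epos := expectation_spareto_excess a_gt0 k_gt1 lawX (lexx mu).
have := expectation_spareto_excess a_gt0 k_gt1
  (spareto_lawN a_gt0 k_gt1 lawX) (lexx (- mu)).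
rewrite (_ : ((- X : {mfun T >-> R}) \- cst (- mu))^\+ =
    (X \- cst mu)^\-); last first.
  by apply/funext => w; rewrite /funrpos /funrneg/= opprB opprK addrC.
move=> Eneg; have [L E] := expectation_funrposneg Epos Eneg.
have XE : (X : T -> R) = (X \- cst mu) \+ cst mu.
  by apply/funext => w /=; rewrite subrK.
have Lc : cst mu \in Lfun P 1 by exact: Lfun_cst.
rewrite XE; split; first exact: rpredD.
rewrite expectationD// E expectation_cst -EFinD !subrr.
by rewrite add0r.
Qed.

(** For [mu <= 0] the half-line above [0] lies beyond the centre, where the tail
    formulas apply; the mean of the negative part is then forced by
    [E X^+ - E X^- = mu].  The closed half-line is included because, applied to
    [- X], it gives the complement of [X > 0]. *)
Lemma spareto_nonpos_parts (X : {RV P >-> R}) :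
  spareto_law X mu a k -> mu <= 0 ->
  let r := - mu / a in
  let H := a / (2 * (k - 1)) * (1 + r) `^ (1 - k) in
  [/\ P (X @^-1` `]0, +oo[) = (2^-1 * (1 + r) `^ (- k))%:E,
      P (X @^-1` `[0, +oo[) = (2^-1 * (1 + r) `^ (- k))%:E,
      'E_P[(X^\+)%R]%E = H%:E &
      'E_P[(X^\-)%R]%E = (H - mu)%:E].
Proof.
move=> lawX mu0 r H.
have k_gt0 : 0 < k by exact: lt_trans k_gt1.
have Epos : 'E_P[(X^\+)%R]%E = H%:E.
  have := expectation_spareto_excess a_gt0 k_gt1 lawX mu0.
  rewrite sub0r (addrC _ 1) => <-; congr expectation.
  by apply/funext => w; rewrite /funrpos/= subr0.
have [L E] := expectation_spareto lawX.
split => //.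
- by rewrite -[LHS]/(ccdf X 0) (ccdf_spareto a_gt0 k_gt1 lawX)// sub0r addrC.
- rewrite -[LHS]/(distribution P X `[0, +oo[) lawX// spareto_upper_tail//.
  by rewrite sub0r addrC.
have Lp : (X^\+ : T -> R)%R \in Lfun P 1.
  by apply: (ge0_Lfun1 _ Epos) => w; exact: funrpos_ge0.
have -> : X^\- = X^\+ \- (X : T -> R).
  by apply/funext => w /=; rewrite -(congr1 (@^~ w) (funrposBneg X)) /=
     opprB addrCA subrr addr0.
by rewrite expectationB// Epos E.
Qed.

End SymmetrizedParetoMoments.

Section ThresholdAlgebra.
Context {R : realType}.

(** Here [r = |mu| / a], [p] is the probability of the side of [0] opposite to
    the centre, [H] the mean of the part on that side and [H + a * r] the mean
    of the other part.  Since [(1 + r) ^ (1 - k) = (1 + r) * (1 + r) ^ (- k)],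
    the denominator [D] simplifies to
    [a * (1 + r) ^ (- k) * (1 + k * r) / (2 * (k - 1))]. *)
Lemma spareto_threshold (a k r : R) : 0 < a -> 1 < k -> 0 <= r ->
  let p := 2^-1 * (1 + r) `^ (- k) in
  let H := a / (2 * (k - 1)) * (1 + r) `^ (1 - k) in
  let F := (1 - (k - 2) * r - (1 + r) `^ (- k + 1)) / (1 + k * r) in
  let D := H * (1 - p) + (H + a * r) * p in
  [/\ 0 < p < 1, 0 <= H, 0 < D & 2^-1 * (1 - F) * D = (H + a * r) * p].
Proof.
move=> a0 k1 r0 p H F D.
have k0 : 0 < k by exact: lt_trans k1.
have r1 : 0 < 1 + r by rewrite ltr_pwDl.
pose y := (1 + r) `^ (- k).
have y0 : 0 < y by exact: powR_gt0.
have y1 : y <= 1.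
  by rewrite /y -[leRHS](powRr0 (1 + r)) ler_powR ?lerDl// oppr_le0 ltW.
have yE : (1 + r) `^ (1 - k) = (1 + r) * y.
  by rewrite powRD ?(gt_eqF r1) ?implybT// powRr1// ltW.
have HE : H = a / (2 * (k - 1)) * ((1 + r) * y) by rewrite /H yE.
have H0 : 0 < H by rewrite mulr_gt0 ?powR_gt0// divr_gt0// mulr_gt0// subr_gt0.
have p0 : 0 < p by rewrite mulr_gt0// invr_gt0.
have p1 : p < 1 by rewrite /p -/y; lra.
split; rewrite ?p0 ?p1 ?ltW//.
  apply: ltr_pwDl; first by rewrite mulr_gt0// subr_gt0.
  apply: mulr_ge0; last exact: ltW.
  by apply: addr_ge0; [exact: ltW|apply: mulr_ge0; [exact: ltW|]].
have kr0 : 0 < 1 + k * r by rewrite ltr_pwDl// mulr_ge0// ltW.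
rewrite /D /F HE /p -/y (addrC (- k)) yE; field.
by rewrite subr_eq0 !gt_eqF.
Qed.

End ThresholdAlgebra.

(** * Sign patterns and the optimal threshold *)

Section Independence.
Context {R : realType} {d : measure_display} {T : measurableType d}.
Variable P : probability T R.

(** The tail integral formula turns the product rule for the events [Y > t]
    into the product rule for the expectation. *)
Lemma ge0_expectation_indep (Y : {RV P >-> R}) (A : set T) :
  measurable A -> (forall w, 0 <= Y w) ->
  (forall t, 0 <= t -> P (Y @^-1` `]t, +oo[ `&` A) = (ccdf Y t * P A)%E) ->
  ('E_P[(fun w => Y w * \1_A w)%R] = 'E_P[Y] * P A)%E.
Proof.
move=> mA Y0 indep.
pose Z : {mfun T >-> R} := Y \* mindic R mA.
rewrite (_ : (fun w => _) = Z)//.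
rewrite !ge0_expectation_ccdf//; last first.
  by move=> w; rewrite /Z/= mulr_ge0// indicE.
rewrite -[P A]fineK ?fin_num_measure// -ge0_integralZr//=; last 2 first.
- exact: (measurable_funTS (ccdf_measurable Y)).
- by rewrite lee_fin fine_ge0.
apply: eq_integral => t; rewrite inE/= in_itv/= andbT => t0.
rewrite fineK ?fin_num_measure// -indep//; congr (P _).
apply/seteqP; split => w /=; rewrite !in_itv/= !andbT /Z/= mindicE.
  case: (boolP (w \in A)) => [/set_mem wA|_].
    by rewrite mulr1.
  by rewrite mulr0 ltNge t0.
by move=> [tY wA]; rewrite mem_set// mulr1.
Qed.

End Independence.

Section SignPatterns.
Context {R : realType} {d : measure_display} {T : measurableType d}.
Variables (P : probability T R) (n : nat) (zeta : 'I_n -> {RV P >-> R}).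
Implicit Types (S : {set 'I_n}) (i j : 'I_n).

Definition sign_ray (b : bool) : set R :=
  if b then `]0%R, +oo[%classic else `]-oo, 0%R]%classic.

Lemma measurable_sign_ray b : measurable (sign_ray b).
Proof. by case: b => /=. Qed.


Lemma mem_sign_ray (b : bool) (x : R) : sign_ray b x <-> (0 < x) = b.
Proof.
rewrite /sign_ray; case: b; rewrite /= in_itv/= ?andbT.
  by [].
by rewrite leNgt; split => [/negbTE|->].
Qed.

Definition sign_pattern (J S : {set 'I_n}) : set T :=
  \bigcap_(j in [set` J]) zeta j @^-1` sign_ray (j \in S).

Lemma sign_patternP (J S : {set 'I_n}) w : sign_pattern J S w <->
  forall j, j \in J -> (0 < zeta j w) = (j \in S).
Proof. by split=> h j jJ; apply/mem_sign_ray/h. Qed.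

Lemma measurable_sign_pattern (J S : {set 'I_n}) :
  measurable (sign_pattern J S).
Proof.
apply: fin_bigcap_measurable => [|j _]; first exact: finite_finset.
by apply: measurable_funPTI => //; exact: measurable_sign_ray.
Qed.

Lemma sign_patternT S w : (w \in sign_pattern [set: 'I_n]%SET S) =
  ([set j | 0 < zeta j w]%SET == S).
Proof.
apply/idP/eqP => [/set_mem /sign_patternP h|<-].
  by apply/setP => j; rewrite inE h// inE.
by apply/mem_set/sign_patternP => j _; rewrite inE.
Qed.

Lemma sign_pattern_split i S w : (w \in sign_pattern [set: 'I_n]%SET S) =
  ((0 < zeta i w) == (i \in S)) && (w \in sign_pattern (~: [set i])%SET S).
Proof.
apply/idP/andP => [/set_mem /sign_patternP h|
    [/eqP hi /set_mem /sign_patternP h]].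
  rewrite h ?finset.in_setT// eqxx; split => //.
  by apply/mem_set/sign_patternP => j _; rewrite h ?finset.in_setT.
apply/mem_set/sign_patternP => j _.
by have [->//|ji] := eqVneq j i; apply: h; rewrite !inE.
Qed.

Hypothesis indep : mutually_independent zeta.

Lemma measure_sign_pattern (J S : {set 'I_n}) : P (sign_pattern J S) =
  (\prod_(j in J) P (zeta j @^-1` sign_ray (j \in S)))%E.
Proof.
apply: (@indep J (fun j => sign_ray (j \in S))) => j.
exact: measurable_sign_ray.
Qed.

(** Mutual independence is applied to the family of rays with the [i]-th one
    replaced by [B]. *)
Lemma indep_sign_pattern i S (B : set R) : measurable B ->
  P (zeta i @^-1` B `&` sign_pattern (~: [set i])%SET S) =
  (P (zeta i @^-1` B) * P (sign_pattern (~: [set i])%SET S))%E.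
Proof.
move=> mB.
pose C j := if j == i then B else sign_ray (j \in S).
have mC j : measurable (C j).
  by rewrite /C; case: ifP => // _; exact: measurable_sign_ray.
have Cne j : j != i -> C j = sign_ray (j \in S) by rewrite /C => /negbTE ->.
have := indep [set: 'I_n]%SET mC.
rewrite (bigD1 i) ?inE//= {2}/C eqxx => h.
rewrite measure_sign_pattern.
transitivity (P (zeta i @^-1` B) *
    \prod_(j in [set: 'I_n]%SET | j != i) P (zeta j @^-1` C j))%E; last first.
  congr (_ * _)%E; apply: eq_big => [j|j /andP[_ /Cne ->]//].
  by rewrite !inE.
rewrite -h; congr (P _); apply/seteqP; split => w.
  move=> [wB wS] j _ /=; rewrite /C; case: eqVneq => [->//|ji].
  by apply: wS; rewrite /= !inE.
move=> h'; split; first by have := h' i; rewrite /C/= eqxx; apply; rewrite inE.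
move=> j; rewrite /= !inE => ji.
by have := h' j; rewrite /= Cne//; apply; rewrite inE.
Qed.

Variables (p U V : R).
Hypothesis p01 : 0 < p < 1.
Hypothesis prob_pos : forall i, P (zeta i @^-1` `]0, +oo[) = p%:E.
Hypothesis expect_pos : forall i, ('E_P[((zeta i)^\+)%R] = U%:E)%E.
Hypothesis expect_neg : forall i, ('E_P[((zeta i)^\-)%R] = V%:E)%E.

Let p_gt0 : 0 < p. Proof. by case/andP: p01. Qed.
Let q_gt0 : 0 < 1 - p. Proof. by rewrite subr_gt0; case/andP: p01. Qed.

Definition pattern_weight S : R := p ^+ #|S| * (1 - p) ^+ (n - #|S|).

Definition mean_given_sign (b : bool) : R :=
  if b then U / p else - (V / (1 - p)).

Lemma measure_sign_ray j b :
  P (zeta j @^-1` sign_ray b) = (if b then p else 1 - p)%:E.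
Proof.
case: b; first exact: prob_pos.
rewrite EFinB -(prob_pos j) -probability_setC; last exact: measurable_funPTI.
congr (P _); apply/seteqP; split => w /=;
  by rewrite !in_itv/= andbT leNgt => /negP.
Qed.

Let card_notin S : #|[pred j | j \notin S]| = (n - #|S|)%N.
Proof.
have h : (#|S| + #|[pred j | j \notin S]| = n)%N.
  by rewrite -[RHS]card_ord; exact: cardC.
by rewrite -[LHS](addKn #|S|) h.
Qed.

Lemma prod_sign_weights S :
  \prod_j (if j \in S then p else 1 - p) = pattern_weight S.
Proof.
rewrite (bigID (mem S))/=; congr (_ * _).
  by rewrite (eq_bigr (fun=> p)) => [|j ->//]; rewrite prodr_const.
rewrite (eq_bigr (fun=> 1 - p)) => [|j /negbTE ->//].
rewrite prodr_const; congr (_ ^+ _).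
exact: card_notin.
Qed.

(** On the full pattern, [zeta i] agrees with [(zeta i)^+] or [- (zeta i)^-]
    according to [i \in S], and that variable already vanishes when the sign of
    [zeta i] is wrong.  The pattern may therefore be replaced by the pattern of
    the other agents, which is independent of [zeta i]. *)
Lemma expectation_sign_pattern i S :
  ('E_P[(fun w => zeta i w * \1_(sign_pattern [set: 'I_n]%SET S) w)%R] =
   (pattern_weight S * mean_given_sign (i \in S))%:E)%E.
Proof.
set A := sign_pattern (~: [set i])%SET S.
have mA : measurable A := measurable_sign_pattern _ _.
have PA : P A = (pattern_weight S / (if i \in S then p else 1 - p))%:E.
  have -> : pattern_weight S / (if i \in S then p else 1 - p) =
      \prod_(j in (~: [set i])%SET) (if j \in S then p else 1 - p).
    rewrite -prod_sign_weights (bigD1 i)//= mulrC mulKf; last first.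
      by case: ifP; rewrite gt_eqF.
    by apply: eq_bigl => j; rewrite !inE.
  rewrite measure_sign_pattern -prodEFin; apply: eq_bigr => j _.
  exact: measure_sign_ray.
rewrite /mean_given_sign; have [iS|iS] := boolP (i \in S).
- rewrite (_ : (fun w => _) = (fun w => (zeta i)^\+ w * \1_A w)).
    rewrite ge0_expectation_indep//; last 2 first.
    - by move=> w; exact: funrpos_ge0.
    - move=> t t0; rewrite /ccdf /distribution /pushforward.
      rewrite (_ : _ @^-1` _ = zeta i @^-1` `]t, +oo[).
        exact: indep_sign_pattern.
      apply/seteqP; split => w /=; rewrite !in_itv/= !andbT;
        by rewrite /funrpos lt_max/= [t < 0]ltNge t0 orbF.
    rewrite expect_pos PA iS -EFinM; congr EFin; field.
    by rewrite gt_eqF.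
  apply/funext => w; rewrite !indicE (sign_pattern_split i) iS eqb_id /funrpos.
  by case: (ltP 0) => h; rewrite ?mul0r ?mulr0.
- transitivity (- 'E_P[(fun w => (zeta i)^\- w * \1_A w)%R])%E.
    rewrite !unlock -integral_ge0N/=; last first.
      by move=> w _; rewrite lee_fin mulr_ge0 ?funrneg_ge0// indicE.
    apply: eq_integral => w _; rewrite -?EFinN; congr EFin.
    rewrite !indicE (sign_pattern_split i) (negbTE iS) eqbF_neg -leNgt.
    rewrite /funrneg -mulNr.
    case: (leP (zeta i w) 0) => h /=.
      by rewrite max_l ?oppr_ge0// opprK.
    by rewrite max_r ?oppr_le0 1?ltW// oppr0 !mul0r mulr0.
  rewrite ge0_expectation_indep//; last 2 first.
  - by move=> w; exact: funrneg_ge0.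
  - move=> t t0; rewrite /ccdf /distribution /pushforward.
      rewrite (_ : _ @^-1` _ = zeta i @^-1` `]-oo, - t[).
      exact: indep_sign_pattern.
    apply/seteqP; split => w /=; rewrite !in_itv/= ?andbT;
      by rewrite /funrneg lt_max/= [t < 0]ltNge t0 orbF ltrNr.
  rewrite expect_neg PA (negbTE iS) -EFinM -EFinN; congr EFin; field.
  by rewrite gt_eqF.
Qed.

Lemma expectation_actual_increment (alpha : R) i :
  ('E_P[actual_increment zeta alpha i] =
   (\sum_(S : {set 'I_n} | alpha * n%:R < #|S|%:R)
      pattern_weight S * mean_given_sign (i \in S))%:E)%E.
Proof.
have intS S : (\int[P]_w (zeta i w * \1_(sign_pattern [set: 'I_n]%SET S) w)%:E =
    (pattern_weight S * mean_given_sign (i \in S))%:E)%E.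
  by rewrite -expectation_sign_pattern unlock.
rewrite -sumEFin -(eq_bigr _ (fun S _ => intS S)) unlock.
rewrite -(integral_sum measurableT (f := fun (S : {set 'I_n}) w =>
  (zeta i w * \1_(sign_pattern [set: 'I_n]%SET S) w)%:E))/=.
  apply: eq_integral => w _; rewrite sumEFin -mulr_sumr; congr (_ * _)%:E.
  rewrite /accepted /votes_for; set A := [set j | _]%SET.
  rewrite (bigID (pred1 A))/= [X in _ + X]big1 => [|S /andP[_ SA]]; last first.
    by rewrite indicE sign_patternT -/A eq_sym (negbTE SA).
  rewrite addr0; case: (boolP (alpha * n%:R < #|A|%:R)) => h /=.
  - rewrite (big_pred1 A)// ?indicE ?sign_patternT ?eqxx// => S /=.
    by apply: andb_idl => /eqP ->.
  - rewrite big_pred0// => S; apply/negbTE.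
    by apply: contra h => /andP[+ /eqP <-].
have integrable_zeta : P.-integrable setT (EFin \o zeta i).
  by have [/Lfun1_integrable] :=
    expectation_funrposneg (expect_pos i) (expect_neg i).
move=> S; have mS := measurable_sign_pattern [set: 'I_n]%SET S.
apply: (le_integrable measurableT _ _ integrable_zeta).
  by apply/measurable_EFinP; apply: measurable_funM.
by move=> w _ /=; rewrite lee_fin normrM indicE; case: (w \in _);
  rewrite ?normr1 ?mulr1 ?normr0 ?mulr0.
Qed.

Let mean_total S : \sum_i mean_given_sign (i \in S) =
  #|S|%:R * (U / p) - (n%:R - #|S|%:R) * (V / (1 - p)).
Proof.
rewrite (bigID (mem S))/=; congr (_ + _).
  rewrite (eq_bigr (fun=> U / p)) => [|j ->//].
  by rewrite sumr_const mulr_natl.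
rewrite (eq_bigr (fun=> - (V / (1 - p)))) => [|j /negbTE ->//].
rewrite sumrN sumr_const; congr (- _); rewrite -[LHS]mulr_natl; congr (_ * _).
rewrite -natrB; last by rewrite (leq_trans (max_card _)) ?card_ord.
by rewrite -card_notin.
Qed.

(** Swapping agents [i] and [j] permutes the patterns and preserves their size,
    on which both the weight and the acceptance depend. *)
Lemma exchangeable_sum (Q : pred nat) i j :
  \sum_(S : {set 'I_n} | Q #|S|) pattern_weight S * mean_given_sign (i \in S) =
  \sum_(S : {set 'I_n} | Q #|S|) pattern_weight S * mean_given_sign (j \in S).
Proof.
have sK : involutive (fun S : {set 'I_n} => (tperm i j @: S)%SET).
  move=> S; rewrite -imset_comp (eq_imset (g := id)) ?imset_id// => x /=.
  by rewrite tpermK.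
have cS S : #|(tperm i j @: S)%SET| = #|S|.
  by rewrite card_imset//; exact: perm_inj.
rewrite (reindex_inj (inv_inj sK)); apply: eq_big => S; first by rewrite cS.
move=> _; rewrite /pattern_weight cS; congr (_ * mean_given_sign _).
by rewrite -[X in X \in _ @: _](tpermR i j) finset.mem_imset//; exact: perm_inj.
Qed.

(** The mean increment is multiplied by [n] and rewritten as a sum over agents;
    the contribution of a pattern [S] becomes a nonnegative multiple of
    [|S| - alpha0 * n], so that [alpha0] keeps the nonnegative terms and drops
    the others. *)
Theorem optimal_threshold_of_means (alpha0 : R) : (0 < n)%N ->
  0 <= U -> 0 <= V -> 0 < U * (1 - p) + V * p ->
  alpha0 * (U * (1 - p) + V * p) = V * p ->
  optimal_threshold zeta alpha0.
Proof.
move=> n0 U0 V0 UV0 alpha0E.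
have nR0 : 0 < n%:R :> R by rewrite ltr0n.
split.
  rewrite in_itv/= (@le_trans _ _ 0) ?oppr_le0 ?invr_ge0//=.
    by rewrite -(ler_pM2r UV0) alpha0E mul1r lerDr mulr_ge0// ltW.
  by rewrite -(pmulr_lge0 _ UV0) alpha0E mulr_ge0// ltW.
move=> beta _ i; rewrite !expectation_actual_increment lee_fin.

have symm Q : n%:R * (\sum_(S : {set 'I_n} | Q #|S|)
      pattern_weight S * mean_given_sign (i \in S)) =
    \sum_(S : {set 'I_n} | Q #|S|) pattern_weight S *
      ((U / p + V / (1 - p)) * (#|S|%:R - alpha0 * n%:R)).
  transitivity (\sum_(j < n) \sum_(S : {set 'I_n} | Q #|S|)
      pattern_weight S * mean_given_sign (j \in S)).
    rewrite (eq_bigr _ (fun j _ => exchangeable_sum Q j i)).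
    by rewrite sumr_const card_ord mulr_natl.
  rewrite exchange_big; apply: eq_bigr => S _.
  rewrite -mulr_sumr mean_total; congr (_ * _).
  have VE : V / (1 - p) = alpha0 * (U / p + V / (1 - p)).
    apply: (@mulIf _ (p * (1 - p))); first by rewrite mulf_neq0// gt_eqF.
    transitivity (V * p); first by field; rewrite gt_eqF.
    by rewrite -alpha0E; field; rewrite !gt_eqF.
  rewrite [RHS](_ : _ = #|S|%:R * (U / p + V / (1 - p)) -
      n%:R * (alpha0 * (U / p + V / (1 - p)))); last by ring.
  by rewrite -VE; ring.
rewrite -(ler_pM2l nR0) (symm (fun m => beta * n%:R < m%:R)).
rewrite (symm (fun m => alpha0 * n%:R < m%:R)).
rewrite big_mkcond [leRHS]big_mkcond; apply: ler_sum => S _.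
have W0 : 0 <= pattern_weight S.
  by rewrite mulr_ge0 ?exprn_ge0 ?ltW.
have M0 : 0 <= U / p + V / (1 - p).
  by rewrite addr_ge0 ?divr_ge0// ltW.
case: (ltP (alpha0 * n%:R)) => h.
  have : 0 <= pattern_weight S *
      ((U / p + V / (1 - p)) * (#|S|%:R - alpha0 * n%:R)).
    by apply: mulr_ge0 => //; apply: mulr_ge0 => //; rewrite subr_ge0 ltW.
  by case: ifP.
case: ifP => // _.
by rewrite mulr_ge0_le0// mulr_ge0_le0// subr_le0.
Qed.

End SignPatterns.

(** * The threshold for the symmetrized Pareto society *)

Theorem corollary5 (R : realType) (d : measure_display) (T : measurableType d)
    (P : probability T R) (n : nat) (zeta : 'I_n -> {RV P >-> R})
    (mu sigma k : R)
    (n_ge1 : (1 <= n)%N) (sigma_gt0 : 0 < sigma) (k_gt2 : 2 < k)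
    (zeta_indep : mutually_independent zeta)
    (zeta_spareto : forall (i : 'I_n) (A : set R), measurable A ->
       distribution P (zeta i) A = spareto_prob mu sigma k A) :
  let rho := mu / sigma in
  let C := spareto_ratio k in
  let rhohat := `|rho / C| in
  let alpha0 := 2^-1 * (1 + Num.sg rho *
    ((1 - (k - 2) * rhohat - (1 + rhohat) `^ (- k + 1)) / (1 + k * rhohat))) in
  optimal_threshold zeta alpha0.
Proof.
move=> rho C rhohat alpha0.
have k_gt1 : 1 < k by apply: lt_trans k_gt2; rewrite ltr1n.
have C_gt0 : 0 < C.
  by rewrite sqrtr_gt0 divr_gt0// mulr_gt0 ?subr_gt0.
pose a := sigma * C.
have a_gt0 : 0 < a by exact: mulr_gt0.
have law i : spareto_law (zeta i) mu a k by exact: zeta_spareto.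
have rhohatE : rhohat = `|mu| / a.
  rewrite /rhohat /rho !normf_div (gtr0_norm sigma_gt0) (gtr0_norm C_gt0).
  by rewrite -mulrA -invfM.
have rhohat_ge0 : 0 <= rhohat by exact: normr_ge0.
have arho : a * rhohat = `|mu| by rewrite rhohatE mulrC divfK// gt_eqF.
have [p01 H_ge0 D_gt0 alphaD] := spareto_threshold a_gt0 k_gt1 rhohat_ge0.
set p := 2^-1 * _ in p01 D_gt0 alphaD.
set H := a / _ * _ in H_ge0 D_gt0 alphaD.
set F := _ / (1 + k * rhohat) in alphaD.
have [p_gt0 p_lt1] := andP p01.
have [mu_le0|mu_gt0] := leP mu 0.
- have rE : - mu / a = rhohat by rewrite rhohatE ler0_norm.
  have amu : a * rhohat = - mu by rewrite arho ler0_norm.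
  have parts i := spareto_nonpos_parts a_gt0 k_gt1 (law i) mu_le0.
  have -> : alpha0 = 2^-1 * (1 - F).
    rewrite /alpha0 -/F; congr (_ * (_ + _)).
    have [mu0|muN0] := eqVneq mu 0.
      (* sg 0 = 0 agrees with the sign -1 because F vanishes at rhohat = 0 *)
      rewrite /rho /F rhohatE mu0 normr0 !mul0r sgr0 mul0r mulr0 addr0 powR1.
      by rewrite subr0 subrr mul0r oppr0.
    by rewrite ltr0_sg ?mulN1r// pmulr_llt0 ?invr_gt0// lt_neqAle muN0.
  apply: (@optimal_threshold_of_means _ _ _ _ _ _ _ p H (H + a * rhohat)) => //.
  + by move=> i; have [+ _ _ _] := parts i; rewrite rE.
  + by move=> i; have [_ _ + _] := parts i; rewrite rE.
  + by move=> i; have [_ _ _] := parts i; rewrite rE amu.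
  + by rewrite amu addr_ge0// oppr_ge0.
- have rE : - - mu / a = rhohat by rewrite opprK rhohatE gtr0_norm.
  have amu : a * rhohat = mu by rewrite arho gtr0_norm.
  have muN_le0 : - mu <= 0 by rewrite oppr_le0 ltW.
  have parts i := spareto_nonpos_parts a_gt0 k_gt1
    (spareto_lawN a_gt0 k_gt1 (law i)) muN_le0.
  have -> : alpha0 = 2^-1 * (1 + F).
    by rewrite /alpha0 -/F gtr0_sg ?mul1r// divr_gt0.
  apply: (@optimal_threshold_of_means _ _ _ _ _ _ _
    (1 - p) (H + a * rhohat) H) => //.
  + by rewrite subr_gt0 p_lt1 gtrBl.
  + move=> i; have [_ + _ _] := parts i; rewrite rE -/p => Pneg.
    rewrite EFinB -Pneg -probability_setC; last exact: measurable_funPTI.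
    congr (P _); apply/seteqP; split => w /=;
      rewrite !in_itv/= !andbT oppr_ge0 leNgt;
      by [move=> ->|move/negP; rewrite negbK].
  + move=> i; have [_ _ _] := parts i; rewrite rE -/H opprK amu => <-.
    by congr expectation; apply/funext => w; rewrite /funrpos /funrneg/= opprK.
  + by move=> i; have [_ _ + _] := parts i; rewrite rE.
  + by rewrite amu addr_ge0// ltW.
  + by rewrite (_ : _ + _ = H * (1 - p) + (H + a * rhohat) * p)//; ring.
  + rewrite [X in _ * X](_ : _ = H * (1 - p) + (H + a * rhohat) * p);
      last by ring.
    rewrite (_ : 2^-1 * (1 + F) = 1 - 2^-1 * (1 - F)); last by field.
    by rewrite mulrBl alphaD; ring.
Qed.
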